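(* Let $G=D_{2m}\le S_m$ ($m\geq 3$) be the dihedral group of degree $m$ and let $V$ be a complex inner product space with $n=\dim V\geq 2$. Case (i): If $m$ is even, then (a) $\dim V^{\lambda_1}(G)=\dim V^{\lambda_3}(G)=n$; (b) $\dim V^{\lambda_2}(G)=\dim V^{\lambda_4}(G)=0$; (c) $\dim V^{\psi_h}(G)=2n$ for every integer $h$ with $0<h<\frac{m}{2}$. Case (ii): If $m$ is odd, then (a) $\dim V^{\lambda_1}(G)=n$; (b) $\dim V^{\lambda_2}(G)=0$; (c) $\dim V^{\psi_h}(G)=2n$ for every integer $h$ with $0<h<\frac{m}{2}$.
   Context: $\times^m V$ is the Cartesian product of $m$ copies of $V$. For $\tau\in G\le S_m$, $Q(\tau):\times^m V\to\times^m V$ is the linear operator $Q(\tau)(u_1,\ldots,u_m)=(u_{\tau^{-1}(1)},\ldots,u_{\tau^{-1}(m)})$. For a complex irreducible character $\lambda$ of $G$, the Cartesian symmetrizer is $C_\lambda=\frac{\lambda(1)}{|G|}\sum_{\tau\in G}\lambda(\tau)Q(\tau)$, and the Cartesian symmetry class associated with $G$ and $\lambda$ is the range $V^\lambda(G)=C_\lambda(\times^m V)$. $D_{2m}$ is the subgroup of $S_m$ ($m\ge 3$) generated by the $m$-cycle $r=(1\ 2\ \cdots\ m)$ and the permutation $s$ with $s(1)=1$ and $s(j)=m+2-j$ for $2\le j\le m$. One has $r^m=1=s^2$, $s^{-1}rs=r^{-1}$ and $D_{2m}=\{r^k, sr^k : 0\le k<m\}$. Its irreducible characters of degree $2$ are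 $\psi_h$ ($h$ an integer, $0<h<m/2$), given by $\psi_h(r^k)=2\cos\frac{2kh\pi}{m}$, $\psi_h(sr^k)=0$ for $0\le k<m$. Its linear characters are: $\lambda_1$, the principal character; $\lambda_2(r^k)=1$, $\lambda_2(sr^k)=-1$; and, when $m$ is even, also $\lambda_3(r^k)=(-1)^k$, $\lambda_3(sr^k)=(-1)^k$, and $\lambda_4(r^k)=(-1)^k$, $\lambda_4(sr^k)=(-1)^{k+1}$. *)

(* Defs.v *)
From HB Require Import structures.
From mathcomp Require Import all_boot all_order all_algebra all_fingroup.
From mathcomp Require Import sesquilinear complex zify.
From mathcomp Require Import reals trigo.

Set Implicit Arguments.
Unset Strict Implicit.
Unset Printing Implicit Defensive.

Import Order.TTheory GRing.Theory Num.Theory.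
Local Open Scope ring_scope.
Local Open Scope complex_scope.

Section Symmetrizer.

Variables (R : realType) (V : vectType R[i]) (m : nat).

Definition permQ (t : 'S_m) (u : {ffun 'I_m -> V}) : {ffun 'I_m -> V} :=
  [ffun i => u ((t^-1)%g i)].

Fact permQ_is_linear t : linear (permQ t).
Proof. by move=> a u v; apply/ffunP=> i; rewrite !ffunE. Qed.

HB.instance Definition _ t :=
  GRing.isLinear.Build R[i] {ffun 'I_m -> V} {ffun 'I_m -> V} *:%R (permQ t)
    (permQ_is_linear t).

(* Only the values of [lambda] on [G] matter. *)
Definition cartesian_symmetrizer (G : {group 'S_m}) (lambda : 'S_m -> R[i]) :
    'End({ffun 'I_m -> V}) :=
  (lambda 1%g / #|G|%:R) *: \sum_(t in G) lambda t *: linfun (permQ t).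

Definition cartesian_symmetry_class (G : {group 'S_m}) (lambda : 'S_m -> R[i]) :
    {vspace {ffun 'I_m -> V}} :=
  limg (cartesian_symmetrizer G lambda).

End Symmetrizer.

Section Dihedral.

Variable m : nat.

(* The points 1, ..., m are represented by 0, ..., m - 1 : 'I_m, so that the
   rotation is i |-> i + 1 and the reflection is i |-> - i, modulo m. *)
Definition drot : 'S_m := perm (@ordS_inj m).

Definition ord_opp (i : 'I_m) : 'I_m :=
  Ordinal (ltn_pmod (m - i) (leq_ltn_trans (leq0n i) (ltn_ord i))).

Fact ord_oppK : involutive ord_opp.
Proof.
move=> i; apply: val_inj => /=; have := ltn_ord i.
case: (posnP i) => [-> m_gt0|i_gt0 lt_im].
  by rewrite subn0 modnn subn0 modnn.
by rewrite (@modn_small (m - i)) ?subKn ?modn_small //; lia.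
Qed.

Definition drefl : 'S_m := perm (inv_inj ord_oppK).

Definition dihedral : {group 'S_m} := <<[set drot; drefl]>>%G.

(* Permutations compose right to left in the symbol s r^k (apply r^k first),
   whereas products in 'S_m compose left to right. *)
Definition sr (k : nat) : 'S_m := (drot ^+ k * drefl)%g.

(* The function with value [a k] at r^k and [b k] at s r^k, for k < m. *)
Definition dihedral_fun (T : nmodType) (a b : nat -> T) (g : 'S_m) : T :=
  if [pick k : 'I_m | g == (drot ^+ k)%g] is Some k then a k
  else if [pick k : 'I_m | g == sr k] is Some k then b k
  else 0.

Lemma rotXE k (i : 'I_m) : (drot ^+ k)%g i = ((i + k) %% m)%N :> nat.
Proof.
elim: k => [|k IHk]; first by rewrite expg0 perm1 addn0 modn_small.
by rewrite expgSr permM permE /= IHk -addn1 modnDml addn1 addnS.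
Qed.

Lemma srE k (i : 'I_m) : sr k i = ((m - (i + k) %% m) %% m)%N :> nat.
Proof. by rewrite permM permE /= rotXE. Qed.

Lemma rotX_inj (j k : nat) :
  (j < m)%N -> (k < m)%N -> (drot ^+ j = drot ^+ k)%g -> j = k.
Proof.
move=> lt_jm lt_km; have m_gt0 : (0 < m)%N by lia.
move=> /(congr1 (fun g : 'S_m => val (g (Ordinal m_gt0)))).
by rewrite /= !rotXE !add0n !modn_small.
Qed.

Lemma rotX_sr_neq (j k : nat) :
  (2 < m)%N -> (j < m)%N -> (k < m)%N -> (drot ^+ j)%g != sr k.
Proof.
move=> m_gt2 lt_jm lt_km; apply/eqP => eq_rs.
have m_gt0 : (0 < m)%N by lia.
have m_gt1 : (1 < m)%N by lia.
have mod1 a : (a < m)%N -> ((1 + a) %% m)%N = if a == m.-1 then 0%N else a.+1.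
  case: eqP => [-> _|ne_a lt_am]; last by rewrite add1n modn_small //; lia.
  by rewrite add1n prednK // modnn.
have modB a : (0 < a <= m)%N -> ((m - a) %% m)%N = (m - a)%N.
  by move=> ?; rewrite modn_small //; lia.
have := congr1 (fun g : 'S_m => val (g (Ordinal m_gt0))) eq_rs.
have := congr1 (fun g : 'S_m => val (g (Ordinal m_gt1))) eq_rs.
rewrite /= !rotXE !srE /= !mod1 // !add0n !(@modn_small j) // !(@modn_small k) //.
case: (posnP k) => [->|k_gt0]; last rewrite (modB k) ?k_gt0 ?(ltnW lt_km) //.
  rewrite subn0 modnn; case: (_ =P m.-1) => [|_]; first lia.
  by rewrite modB //; case: eqP; lia.
case: (k =P m.-1) => [|_]; last by rewrite modB //; case: eqP; lia.
by rewrite subn0 modnn; case: eqP; lia.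
Qed.

Lemma dihedral_fun_rot (T : nmodType) (a b : nat -> T) k :
  (k < m)%N -> dihedral_fun a b (drot ^+ k)%g = a k.
Proof.
move=> lt_km; rewrite /dihedral_fun; case: pickP => [j /eqP|].
  by move/rotX_inj => ->.
by move/(_ (Ordinal lt_km)); rewrite eqxx.
Qed.

Lemma dihedral_fun_sr (T : nmodType) (a b : nat -> T) k :
  (2 < m)%N -> (k < m)%N -> dihedral_fun a b (sr k) = b k.
Proof.
move=> m_gt2 lt_km; rewrite /dihedral_fun; case: pickP => [j|_].
  by rewrite eq_sym (negPf (rotX_sr_neq _ _ _)).
case: pickP => [j /eqP/mulIg|]; first by move/rotX_inj => ->.
by move/(_ (Ordinal lt_km)); rewrite eqxx.
Qed.

End Dihedral.

Section Characters.

Variables (R : realType) (m : nat).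

Definition lambda1 : 'S_m -> R[i] := dihedral_fun (fun=> 1) (fun=> 1).

Definition lambda2 : 'S_m -> R[i] := dihedral_fun (fun=> 1) (fun=> -1).

(* [lambda3] and [lambda4] are characters only for even [m]. *)
Definition lambda3 : 'S_m -> R[i] :=
  dihedral_fun (fun k => (-1) ^+ k) (fun k => (-1) ^+ k).

Definition lambda4 : 'S_m -> R[i] :=
  dihedral_fun (fun k => (-1) ^+ k) (fun k => (-1) ^+ k.+1).

Definition psi (h : nat) : 'S_m -> R[i] :=
  dihedral_fun
    (fun k => (2 * cos (2 * k%:R * h%:R * pi / m%:R))%:C)
    (fun=> 0).

End Characters.

Arguments lambda1 R m : clear implicits.
Arguments lambda2 R m : clear implicits.
Arguments lambda3 R m : clear implicits.
Arguments lambda4 R m : clear implicits.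
Arguments psi R m h : clear implicits.

(* Main.v *)
(* On the rotations of the dihedral group each of the characters is a sum
   k |-> sum_l z_l^k over d distinct m-th roots of unity, and on s r^k it is
   e times that, with e = 1 or -1 and z_l = 1 or -1 if d = 1, and e = 0 if
   d = 2.  Hence the symmetrizer acts on m-tuples of vectors through the matrix
   sum_l z_l^(i - j), scaled by a multiple of 1 + e.  This matrix has rank d by
   orthogonality of roots of unity, and a matrix of rank d acting on tuples of
   vectors of V has an image of dimension d * dim V. *)
From HB Require Import structures.
Require Import Defs.
From mathcomp Require Import all_boot all_order all_algebra all_fingroup.
From mathcomp Require Import sesquilinear complex zify ring.
From mathcomp Require Import reals trigo.

Set Implicit Arguments.
Unset Strict Implicit.
Unset Printing Implicit Defensive.

Import GRing.Theory Num.Theory.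
Local Open Scope ring_scope.
Local Open Scope complex_scope.

(** * Scalar matrices acting on tuples of vectors *)

Section MatrixAction.

Variables (F : fieldType) (V : vectType F).

(** This is [A] tensored with the identity of [V], once V^q is identified with F^q tensor V. *)
Definition mx_act p q (A : 'M[F]_(p, q)) (u : {ffun 'I_q -> V}) :
    {ffun 'I_p -> V} :=
  [ffun i => \sum_j A i j *: u j].

Fact mx_act_is_linear p q (A : 'M[F]_(p, q)) : linear (mx_act A).
Proof.
move=> a u v; apply/ffunP=> i; rewrite !ffunE scaler_sumr -big_split /=.
by apply: eq_bigr => j _; rewrite !ffunE scalerDr !scalerA mulrC.
Qed.

HB.instance Definition _ p q (A : 'M[F]_(p, q)) :=
  GRing.isLinear.Build F {ffun 'I_q -> V} {ffun 'I_p -> V} *:%R (mx_act A)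
    (mx_act_is_linear A).

Lemma mx_actM p q r (A : 'M[F]_(p, q)) (B : 'M[F]_(q, r)) u :
  mx_act (A *m B) u = mx_act A (mx_act B u).
Proof.
apply/ffunP=> i; rewrite !ffunE.
under [RHS]eq_bigr do rewrite ffunE scaler_sumr.
rewrite exchange_big /=; apply: eq_bigr => k _.
by rewrite mxE scaler_suml; apply: eq_bigr => j _; rewrite scalerA.
Qed.

Lemma mx_act1 p u : mx_act (1%:M : 'M[F]_p) u = u.
Proof.
apply/ffunP=> i; rewrite ffunE (bigD1 i) //= mxE eqxx scale1r big1 ?addr0 //.
by move=> j /negPf neq_ji; rewrite mxE eq_sym neq_ji scale0r.
Qed.

(** Factor [A] through its rank: [row_base A] has a right inverse, so it acts surjectively, and
    [col_base A] has a left inverse, so it acts injectively. The image is thus a copy of [\rank A]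
    factors of [V]. *)
Lemma dim_limg_mx_act p q (A : 'M[F]_(p, q)) :
  \dim (limg (linfun (mx_act A))) = (\rank A * \dim {:V})%N.
Proof.
pose P : 'Hom({ffun 'I_(\rank A) -> V}, {ffun 'I_p -> V}) :=
  linfun (mx_act (col_base A)).
pose Q : 'Hom({ffun 'I_q -> V}, {ffun 'I_(\rank A) -> V}) :=
  linfun (mx_act (row_base A)).
have [B BA1] := row_fullP (col_base_full A).
have [C AC1] := row_freeP (row_base_free A).
have -> : linfun (mx_act A) = (P \o Q)%VF.
  by apply/lfunP=> u; rewrite comp_lfunE !lfunE /= -mx_actM mulmx_base.
have fullQ : limg Q = fullv.
  apply/eqP; rewrite eqEsubv subvf; apply/subvP=> w _.
  suff -> : w = Q (mx_act C w) by apply/memv_img/memvf.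
  by rewrite lfunE /= -mx_actM AC1 mx_act1.
have kerP : lker P == 0%VS.
  apply/lker0P=> v w; rewrite !lfunE /= => /(congr1 (mx_act B)).
  by rewrite -!mx_actM BA1 !mx_act1.
rewrite limg_comp fullQ limg_dim_eq ?(eqP kerP) ?capv0 // !dimvf.
by rewrite /dim /= card_ord.
Qed.

End MatrixAction.

(** * Orthogonality of roots of unity *)

Section RootsOfUnity.

Variables (F : fieldType) (m : nat).
Hypothesis m_neq0 : m%:R != 0 :> F.

Lemma sum_unity_root (z : F) :
  z ^+ m = 1 -> \sum_(i < m) z ^+ i = (m * (z == 1))%:R.
Proof.
move=> zm1; have [->|z_neq1] := eqVneq z 1.
  by under eq_bigr do rewrite expr1n; rewrite sumr_const card_ord muln1.
apply/(@mulfI _ (z - 1)); first by rewrite subr_eq0.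
by rewrite -subrX1 zm1 subrr muln0 mulr0.
Qed.

Definition unity_mx d (z : 'I_d -> F) : 'M[F]_m :=
  \matrix_(i, j) \sum_l z l ^+ i / z l ^+ j.

(** The matrix factors as [A *m B] through F^d, and orthogonality gives [B *m A] = m times the
    identity. As m is invertible, [A] has full column rank and [B] full row rank. *)
Lemma rank_unity_mx d (z : 'I_d -> F) :
  injective z -> (forall l, z l ^+ m = 1) -> \rank (unity_mx z) = d.
Proof.
move=> z_inj zm1.
pose A : 'M[F]_(m, d) := \matrix_(i, l) z l ^+ i.
pose B : 'M[F]_(d, m) := \matrix_(l, j) (z l ^+ j)^-1.
have z_neq0 l : z l != 0.
  apply: contra_eq_neq (zm1 l) => ->; rewrite expr0n eq_sym.
  by case: (m) m_neq0 => [|k _]; rewrite ?eqxx ?oner_neq0.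
have BA : B *m A = m%:R%:M.
  apply/matrixP=> l k; rewrite !mxE.
  under eq_bigr do rewrite !mxE mulrC -expr_div_n.
  rewrite sum_unity_root ?expr_div_n ?zm1 ?divr1 //.
  (* The ratio of two of the roots is 1 only on the diagonal, because [z] is injective. *)
  rewrite -(inj_eq (mulIf (z_neq0 l))) divfK // mul1r (inj_eq z_inj) eq_sym.
  by case: eqP; rewrite ?muln1 ?muln0 ?mulr1n ?mulr0n.
have -> : unity_mx z = A *m B.
  by apply/matrixP=> i j; rewrite !mxE; apply: eq_bigr => l _; rewrite !mxE.
rewrite mxrankMfree; last first.
  apply/row_freeP; exists (m%:R^-1 *: A).
  by rewrite -scalemxAr BA scale_scalar_mx mulVf.
apply/eqP/row_fullP; exists (m%:R^-1 *: B).
by rewrite -scalemxAl BA scale_scalar_mx mulVf.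
Qed.

End RootsOfUnity.

(** * The exponential of a purely imaginary number *)

Section ComplexExponential.

Variable R : realType.

Definition expi (t : R) : R[i] := cos t +i* sin t.

Lemma expi0 : expi 0 = 1.
Proof. by rewrite /expi cos0 sin0. Qed.

Lemma expiD t x : expi (t + x) = expi t * expi x.
Proof.
apply/eqP; rewrite eq_complex /= cosD sinD eqxx /=.
by rewrite addrC.
Qed.

Lemma expiV t : (expi t)^-1 = expi (- t).
Proof.
have eN : expi t * expi (- t) = 1 by rewrite -expiD subrr expi0.
have e_neq0 : expi t != 0.
  by apply: contra_eq_neq eN => ->; rewrite mul0r eq_sym oner_neq0.
by apply: (mulfI e_neq0); rewrite divff.
Qed.

Lemma expiX t k : expi t ^+ k = expi (k%:R * t).
Proof.
elim: k => [|k IHk]; first by rewrite mul0r expi0.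
by rewrite exprS IHk -expiD -natr1 mulrDl mul1r addrC.
Qed.

End ComplexExponential.

(** * Enumeration of the dihedral group *)

Section DihedralElements.

Variable m : nat.
Hypothesis m_gt2 : (2 < m)%N.

Local Notation r := (drot m).
Local Notation s := (drefl m).

Lemma drotXm : (r ^+ m = 1)%g.
Proof.
by apply/permP=> i; apply/val_inj; rewrite /= rotXE perm1 modnDr modn_small.
Qed.

Lemma dreflK : (s * s = 1)%g.
Proof. by apply/permP=> i; rewrite permM !permE /= ord_oppK. Qed.

Lemma drotJ : (r ^ s = r^-1)%g.
Proof.
have s_inv : (s^-1 = s)%g by rewrite -[LHS]mulg1 -dreflK mulKg.
apply/eqP; rewrite eq_sym eq_invg_mul conjgE s_inv; apply/eqP/permP=> i.
apply/val_inj; rewrite perm1 !permM !permE /=.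
(* Reduction modulo m wraps around only at i = m - 1 and at i = 0; these points are treated
   apart. *)
have := ltn_ord i; have [eq_im _|neq_im lt_im] := eqVneq i.+1 m.
  rewrite eq_im modnn subn0 modnn (@modn_small 1) ?(@modn_small (m - 1)); lia.
rewrite (@modn_small i.+1); last by lia.
rewrite (@modn_small (m - i.+1)); last by lia.
rewrite (_ : (m - i.+1).+1 = m - i)%N; last by lia.
have [->|i_neq0] := eqVneq (i : nat) 0%N; first by rewrite subn0 modnn subn0 modnn.
by rewrite (@modn_small (m - i)) ?subKn ?modn_small //; lia.
Qed.

(** Since [s] normalizes the cyclic group of [r], the generated group is the product of the two
    cyclic groups; exponents of [r] then matter modulo m and those of [s] modulo 2. *)
Lemma dihedralE :
  dihedral m = [set (r ^+ k)%g | k : 'I_m] :|: [set sr m k | k : 'I_m] :> {set _}.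
Proof.
have m_gt0 : (0 < m)%N by lia.
have rX k : (r ^+ k = r ^+ (k %% m))%g.
  by rewrite {1}(divn_eq k m) expgD mulnC expgM drotXm expg1n mul1g.
apply/setP=> t; apply/idP/setUP; last first.
  have r_in : r \in dihedral m by rewrite mem_gen // !inE eqxx.
  have s_in : s \in dihedral m by rewrite mem_gen // !inE eqxx orbT.
  by case=> /imsetP[k _ ->]; rewrite ?groupM ?groupX.
rewrite /= -[<<_>>%g]/([set r] <*> [set s])%g -joing_idl -joing_idr.
rewrite norm_joinEr; last by rewrite norms_cycle drotJ groupV cycle_id.
case/mulsgP=> _ _ /cycleP[a ->] /cycleP[b ->] ->.
rewrite rX -(odd_double_half b) expgD -mul2n expgM [(s ^+ 2)%g]dreflK expg1n mulg1.
case: (odd b); [right | left]; apply/imsetP; exists (Ordinal (ltn_pmod a m_gt0)) => //.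
by rewrite expg0 mulg1.
Qed.

Lemma sum_dihedral (T : nmodType) (f : 'S_m -> T) :
  \sum_(t in dihedral m) f t =
  \sum_(k < m) f (r ^+ k)%g + \sum_(k < m) f (sr m k).
Proof.
have rot_inj : injective (fun k : 'I_m => (r ^+ k)%g).
  by move=> j k /rotX_inj eq_jk; apply/val_inj/eq_jk.
have sr_inj : injective (fun k : 'I_m => sr m k).
  by move=> j k /mulIg/rot_inj.
rewrite dihedralE.
rewrite -(big_imset f (h := fun k : 'I_m => (r ^+ k)%g)); last by move=> ? ? _ _ /rot_inj.
rewrite -(big_imset f (h := fun k : 'I_m => sr m k)); last by move=> ? ? _ _ /sr_inj.
rewrite -bigU /=; last first.
  rewrite disjoint_subset; apply/subsetP=> _ /imsetP[j _ ->].
  by apply/negP=> /imsetP[k _ /eqP]; apply/negP/rotX_sr_neq.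
by apply: eq_bigl => t; rewrite !inE.
Qed.

End DihedralElements.

(** * Dimensions of the symmetry classes *)

Section SymmetryClass.

Variables (R : realType) (V : vectType R[i]) (m : nat).
Hypothesis m_gt2 : (2 < m)%N.

Lemma cartesian_symmetrizerE (G : {group 'S_m}) (lambda : 'S_m -> R[i])
    (u : {ffun 'I_m -> V}) i :
  cartesian_symmetrizer V G lambda u i =
    (lambda 1%g / #|G|%:R) *: \sum_(t in G) lambda t *: u (t^-1%g i).
Proof.
rewrite scale_lfunE sum_lfunE !ffunE sum_ffunE; congr (_ *: _).
by apply: eq_bigr => t _; rewrite scale_lfunE lfunE !ffunE.
Qed.

(** The family [t] contains exactly one permutation sending a given j to i, so a sum over the family
    turns into a sum over positions j. This reads off the matrix of the rotation half and of the
    reflection half of the symmetrizer. *)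
Lemma reindex_positions (t : nat -> 'S_m) (a : nat -> R[i])
    (f : 'I_m -> 'I_m -> R[i]) (u : 'I_m -> V) i :
  (forall j, injective (fun k : 'I_m => t k j)) ->
  (forall k j : 'I_m, a k = f (t k j) j) ->
  \sum_(k < m) a k *: u ((t k)^-1%g i) = \sum_j f i j *: u j.
Proof.
move=> t_inj af.
have h_inj : injective (fun k : 'I_m => (t k)^-1%g i).
  move=> k k' eq_kk'; apply: (t_inj ((t k)^-1%g i)) => /=.
  by rewrite {2}eq_kk' !permKV.
rewrite [RHS](reindex_inj h_inj); apply: eq_bigr => k _.
by rewrite (af k ((t k)^-1%g i)) permKV.
Qed.

(** The reflection half has entries e times the sum of z_l^-(i + j). The condition
    [e / z l = e * z l] turns them into e times z_l^(i - j), the shape of the rotation half; it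
    covers both e = 0 and self-inverse roots. *)
Lemma dim_symmetry_class d (z : 'I_d -> R[i]) (e : R[i])
    (a b : nat -> R[i]) :
  (0 < d)%N -> injective z -> (forall l, z l ^+ m = 1) ->
  (forall l, e / z l = e * z l) ->
  (forall k, a k = \sum_l z l ^+ k) -> (forall k, b k = e * a k) ->
  \dim (cartesian_symmetry_class V (dihedral m) (dihedral_fun a b)) =
    (if e == -1%R then 0 else d * \dim {:V})%N.
Proof.
move=> d_gt0 z_inj zm1 ez aE bE; have m_gt0 : (0 < m)%N by lia.
have zX l k : z l ^+ k != 0.
  rewrite expf_neq0 //; apply: contra_eq_neq (zm1 l) => ->.
  by rewrite expr0n -(prednK m_gt0) eq_sym oner_neq0.
(* The reflection sends k to -k modulo m, which powers of m-th roots of unity see as inversion. *)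
have exprB_mod l k : z l ^+ ((m - k %% m) %% m) = (z l ^+ k)^-1.
  apply: (mulIf (zX l k)); rewrite mulVf // expr_mod // -(@expr_mod _ m _ k) //.
  by rewrite -exprD subnK // ltnW // ltn_pmod.
have ezX l k : e / z l ^+ k = e * z l ^+ k.
  elim: k => [|k IHk]; first by rewrite expr0 invr1.
  by rewrite exprS invfM [LHS]mulrA ez mulrAC IHk mulrAC mulrA.
have rot_inj (j : 'I_m) : injective (fun k : 'I_m => (drot m ^+ k)%g j).
  move=> k k' /(congr1 val) /=; rewrite !rotXE => /eqP.
  by rewrite eqn_modDl !modn_small // => /eqP/val_inj.
(* The degree d is the value at the identity; 1 + e collects the two halves, so [c] vanishes exactly
   when e = -1. *)
pose c : R[i] := d%:R / #|dihedral m|%:R * (1 + e).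
have -> : cartesian_symmetry_class V (dihedral m) (dihedral_fun a b) =
    limg (linfun (mx_act (V := V) (c *: unity_mx m z))).
  congr (limg _); apply/lfunP=> u; apply/ffunP=> i.
  rewrite cartesian_symmetrizerE lfunE ffunE sum_dihedral //.
  have -> : dihedral_fun a b (1%g : 'S_m) = d%:R.
    rewrite -[1%g](expg0 (drot m)) dihedral_fun_rot // aE.
    by under eq_bigr do rewrite expr0; rewrite sumr_const card_ord.
  under eq_bigr do rewrite dihedral_fun_rot //.
  under [X in _ + X]eq_bigr do rewrite dihedral_fun_sr //.
  rewrite (@reindex_positions _ a (unity_mx m z)); first last.
  - move=> k j; rewrite aE mxE; apply: eq_bigr => l _.
    by rewrite rotXE expr_mod // exprD mulrC mulKf.
  - exact: rot_inj.
  rewrite (@reindex_positions _ b (e *: unity_mx m z)); first last.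
  - move=> k j; rewrite bE aE !mxE !mulr_sumr; apply: eq_bigr => l _.
    by rewrite srE exprB_mod mulrA ezX exprD [z l ^+ j * _]mulrC mulrA mulfK.
  - by move=> j k k'; rewrite !permM => /perm_inj/rot_inj.
  rewrite -big_split scaler_sumr; apply: eq_bigr => j _ /=.
  rewrite [in RHS]mxE [X in _ + X *: _]mxE -scalerDl scalerA; congr (_ *: _).
  by rewrite /c; ring.
rewrite dim_limg_mx_act; have [e_eq|e_neq] := eqVneq e (-1).
  by rewrite /c e_eq subrr mulr0 scale0r mxrank0 mul0n.
rewrite mxrank_scale_nz ?rank_unity_mx //.
  by rewrite pnatr_eq0 -lt0n.
rewrite !mulf_neq0 ?invr_neq0 ?pnatr_eq0 -?lt0n ?cardG_gt0 //.
by rewrite addrC addr_eq0.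
Qed.

Lemma dim_symmetry_class_linear (z e : R[i]) (a b : nat -> R[i]) :
  z ^+ m = 1 -> z^-1 = z ->
  (forall k, a k = z ^+ k) -> (forall k, b k = e * z ^+ k) ->
  \dim (cartesian_symmetry_class V (dihedral m) (dihedral_fun a b)) =
    (if e == -1%R then 0 else \dim {:V})%N.
Proof.
move=> zm1 zV aE bE.
rewrite (@dim_symmetry_class 1 (fun=> z) e) ?mul1n //.
- by move=> j k _; rewrite !ord1.
- by move=> l; rewrite zV.
- by move=> k; rewrite big_ord1.
- by move=> k; rewrite bE aE.
Qed.

(** Here 2 cos(k w) is the sum of the k-th powers of exp(i w) and its inverse, with w = 2 pi h / m,
    and e = 0. *)
Lemma dim_symmetry_class_psi h : (0 < h)%N -> (2 * h < m)%N ->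
  \dim (cartesian_symmetry_class V (dihedral m) (psi R m h)) =
    (2 * \dim {:V})%N.
Proof.
move=> h_gt0 lt_hm; pose w : R := 2 * h%:R * pi / m%:R.
have m_neq0 : m%:R != 0 :> R by rewrite pnatr_eq0; lia.
have wm1 : expi w ^+ m = 1.
  have mw : m%:R * w = h%:R * (pi *+ 2) by rewrite /w -mulr_natr; field.
  by rewrite expiX mw -expiX /expi cos2pi sin2pi expr1n.
(* The bounds on h place w strictly between 0 and pi; a nonzero sine separates exp(i w) from its
   inverse. *)
have sin_w : sin w != 0.
  have m_gt0 : (0 < m)%N by lia.
  apply/lt0r_neq0/sin_gt0_pi; rewrite /w -natrM.
  rewrite divr_gt0 ?mulr_gt0 ?pi_gt0 ?ltr0n ?muln_gt0 //=.
  by rewrite ltr_pdivrMr ?ltr0n // mulrC ltr_pM2l ?pi_gt0 // ltr_nat.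
pose z (l : 'I_2) := if l == ord0 then expi w else (expi w)^-1.
rewrite /psi (@dim_symmetry_class 2 z 0) //.
- by rewrite eq_sym oppr_eq0 oner_eq0.
- have neq_wV : expi w != (expi w)^-1.
    rewrite expiV eq_complex /= cosN sinN eqxx /=.
    by rewrite -addr_eq0 -mulr2n mulrn_eq0.
  move=> [[|[|//]] j_lt] [[|[|//]] k_lt] /eqP; rewrite /z -!val_eqE /=.
  + by move=> _; apply/val_inj.
  + by rewrite (negPf neq_wV).
  + by rewrite eq_sym (negPf neq_wV).
  + by move=> _; apply/val_inj.
- by move=> l; rewrite /z; case: eqP; rewrite ?exprVn wm1 ?invr1.
- by move=> l; rewrite !mul0r.
- move=> k; rewrite big_ord_recl big_ord1 /z /= exprVn expiX expiV.
  have -> : 2 * k%:R * h%:R * pi / m%:R = k%:R * w by rewrite /w; field.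
  apply/eqP; rewrite eq_complex /= cosN sinN subrr eqxx andbT.
  by rewrite mulr_natl mulr2n.
- by move=> k; rewrite mul0r.
Qed.

End SymmetryClass.

Theorem theorem4p1 (R : realType) (V : vectType R[i])
    (dot : {dot V for @Num.conj R[i]}) (m n : nat) (hm : (3 <= m)%N)
    (hdim : \dim {:V} = n) (hn : (2 <= n)%N) :
  let dimV (lambda : 'S_m -> R[i]) : nat := \dim (cartesian_symmetry_class V (dihedral m) lambda) in
  (~~ odd m ->
     [/\ dimV (lambda1 R m) = n /\ dimV (lambda3 R m) = n,
         dimV (lambda2 R m) = 0%N /\ dimV (lambda4 R m) = 0%N
       & forall h : nat, (0 < h)%N -> (2 * h < m)%N -> dimV (psi R m h) = (2 * n)%N])
  /\
  (odd m ->
     [/\ dimV (lambda1 R m) = n,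
         dimV (lambda2 R m) = 0%N
       & forall h : nat, (0 < h)%N -> (2 * h < m)%N -> dimV (psi R m h) = (2 * n)%N]).
Proof.
move=> dimV.
have one_neqN1 : (1 == -1 :> R[i]) = false.
  by rewrite -addr_eq0 -mulr2n pnatr_eq0.
have dim1 : dimV (lambda1 R m) = n.
  rewrite /dimV /lambda1 (@dim_symmetry_class_linear _ _ _ _ 1 1) ?one_neqN1 ?expr1n ?invr1 //.
  - by move=> k; rewrite expr1n.
  - by move=> k; rewrite expr1n mulr1.
have dim2 : dimV (lambda2 R m) = 0%N.
  rewrite /dimV /lambda2 (@dim_symmetry_class_linear _ _ _ _ 1 (-1)) ?eqxx ?expr1n ?invr1 //.
  - by move=> k; rewrite expr1n.
  - by move=> k; rewrite expr1n mulr1.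
have dim_psi h : (0 < h)%N -> (2 * h < m)%N -> dimV (psi R m h) = (2 * n)%N.
  by rewrite -hdim; apply: dim_symmetry_class_psi.
(* Only the claims on [lambda3] and [lambda4] remain: both take z = -1, an m-th root of unity
   because m is even, with e = 1 and e = -1 respectively. *)
split=> [m_even|_]; split=> //; split=> //.
- rewrite /dimV /lambda3 (@dim_symmetry_class_linear _ _ _ _ (-1) 1) ?one_neqN1 ?invrN1 //.
  + by rewrite -signr_odd (negPf m_even).
  + by move=> k; rewrite mul1r.
- rewrite /dimV /lambda4 (@dim_symmetry_class_linear _ _ _ _ (-1) (-1)) ?eqxx ?invrN1 //.
  + by rewrite -signr_odd (negPf m_even).
  + by move=> k; rewrite exprS.
Qed.
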